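(* Let $\eta=\log\mu$ satisfy the log-linear model $$\eta_{jk}=\alpha+\rho_j+\gamma_k+z_{jk}^T\vec\theta,\qquad 0\le j\le J,\ 0\le k\le K,$$ that is, $\vec\eta\in\mathscr H$, and assume any of the four sampling schemes (M), (P), (MR), (MC), with associated space $\mathscr N$ (all described in the context). Let $\lambda=(\gamma^\circ,\vec\theta)$ with $\gamma^\circ=(\gamma_1,\dots,\gamma_K)$. Then the asymptotic covariance matrix of the estimator $\hat\lambda=(\hat\gamma^\circ,\vec{\hat\theta})$ is $$\Sigma_{\hat\lambda}=\begin{pmatrix} B^T\\ (Z^{\circ})^{-}C^T\end{pmatrix}\Sigma_{\hat\eta}\begin{pmatrix} B, & C\,(Z^{\circ})^{-T}\end{pmatrix},$$ or, in block notation, $$\Sigma_{\hat\lambda}=\begin{pmatrix}\Sigma_{\hat\gamma^\circ}&\Sigma_{\hat\gamma^\circ\hat\theta}\\ \Sigma_{\hat\theta\hat\gamma^\circ}&\Sigma_{\hat\theta}\end{pmatrix}.$$ In particular the asymptotic covariance matrix of $\vec{\hat\theta}$ is $$\Sigma_{\hat\theta}=(Z^{\circ})^{-}C^T P^D_{\mathscr H}D^{-1}C\,(Z^{\circ})^{-T},$$ and it does not depend on the space $\mathscr N$ (which determines the sampling scheme): the same expression in terms of $D=\mathrm{diag}\{\vec\mu\}$ holds for each of the four choices of $\mathscr N$.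
   Context: Tables. $J,K\ge 1$ are integers and $I=(J+1)(K+1)$. Tables $a=(a_{jk})$ with $0\le j\le J$, $0\le k\le K$ are identified with vectors $\vec a\in\mathbb R^I$ by stacking columns. $\vec e_{jk}\in\mathbb R^I$ is the unit vector of the table with a one at position $(j,k)$ and zeros elsewhere; a subscript $+$ denotes summation over the replaced index, e.g. $\vec e_{j+}=\sum_k\vec e_{jk}$, $\vec e_{+k}=\sum_j\vec e_{jk}$, $\vec e_{++}=\sum_{j,k}\vec e_{jk}$. Tables indexed by $j=1,\dots,J$, $k=1,\dots,K$ are vectorized in the same way into $\mathbb R^{JK}$. Spaces. $\mathscr D=\mathrm{span}\{\vec e_{++}\}$, $\mathscr R=\mathrm{span}\{\vec e_{0+},\dots,\vec e_{J+}\}$, $\mathscr C=\mathrm{span}\{\vec e_{+0},\dots,\vec e_{+K}\}$, $\mathscr T=\mathscr R+\mathscr C$. Projections. For a symmetric positive definite $I\times I$ matrix $D$ and a linear subspace $\mathscr M\subset\mathbb R^I$, $P^D_{\mathscr M}$ is the ($I\times I$ matrix of the) orthogonal projection onto $\mathscr M$ with respect to the inner product $\langle a,b\rangle_D=a^TDb$. Model. $R=(R_{jk})$ is a random table of counts with expected table $\mu=(\mu_{jk})=\mathbb E(R)$, all $\mu_{jk}>0$, $\eta_{jk}=\log\mu_{jk}$, $D=\mathrm{diag}\{\vec\mu\}$. The model is $\eta_{jk}=\alpha+\rho_j+\gamma_k+z_{jk}^T\vec\theta$ with $\rho_0=\gamma_0=0$, known vectors $z_{jk}\in\mathbb R^L$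 with $z_{j0}=z_{0k}=0$ for all $j,k$, and unknown $\vec\theta\in\mathbb R^L$; the parameters $\alpha$, $\rho_j$ $(j>0)$, $\gamma_k$ $(k>0)$, $\vec\theta$ are otherwise unrestricted. $\mathscr H\subset\mathbb R^I$ is the linear space of all vectors $\vec\eta$ of this form (so $\mathscr T\subset\mathscr H$). $Z^\circ$ is the $JK\times L$ matrix with rows $z_{jk}^T$, $j,k>0$; it is assumed to have rank $L$, and $(Z^\circ)^-=((Z^\circ)^TZ^\circ)^{-1}(Z^\circ)^T$ is its left inverse, $(Z^\circ)^{-T}$ the transpose of $(Z^\circ)^-$. $C$ is the $I\times JK$ matrix with columns $c_{jk}=\vec e_{jk}+\vec e_{00}-\vec e_{j0}-\vec e_{0k}$, $j,k>0$ (ordered as the rows of $Z^\circ$), and $B$ is the $I\times K$ matrix with columns $b_k=\vec e_{0k}-\vec e_{00}$, $k=1,\dots,K$. Sampling schemes. (M): $\vec R$ is multinomial with fixed total $n$; (P): the $R_{jk}$ are independent Poisson; (MR): the rows of $R$ are independent multinomial with fixed row totals; (MC): the columns of $R$ are independent multinomial with fixed column totals. The associated space is $\mathscr N=\mathscr D$ for (M), $\mathscr N=\{0\}$ for (P), $\mathscr N=\mathscr R$ for (MR), $\mathscr N=\mathscr C$ for (MC). Estimators and asymptotic covariance matrices. $\hat\mu$ is the maximum likelihood estimator of $\mu$ under $\vec\eta\in\mathscr H$, $\hat\eta=\log\hat\mu$, and $\hat\gamma^\circ,\vec{\hat\theta}$ are the parameter values in the model representation of $\hat\eta$ (the parameters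 are linear functions of $\vec\eta\in\mathscr H$). By a theorem of Haberman (fixed cells, suitably increasing expectations), $\vec{\hat\eta}$ is asymptotically normal with asymptotic covariance matrix $\Sigma_{\hat\eta}=[P^D_{\mathscr H}-P^D_{\mathscr N}]D^{-1}$; this is taken as given. The asymptotic covariance matrix of an estimator that is a linear function $A\vec{\hat\eta}$ of $\vec{\hat\eta}$ is $A\Sigma_{\hat\eta}A^T$. *)

(* Defs.v *)
From HB Require Import structures.
From mathcomp Require Import all_boot all_order all_algebra.
From mathcomp Require Import all_classical all_reals all_analysis.

Set Implicit Arguments.
Unset Strict Implicit.
Unset Printing Implicit Defensive.

Import Order.TTheory GRing.Theory Num.Theory.

Local Open Scope classical_set_scope.
Local Open Scope ring_scope.

(* [mxvec] concatenates rows, hence the transposes: [vec a] stacks the columns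
   of the table [a].  With m = J+1 and n = K+1 its length is I = (J+1)(K+1). *)
Definition vec (R : Type) (m n : nat) (a : 'M[R]_(m, n)) : 'cV[R]_(n * m) :=
  (mxvec a^T)^T.

Definition unit_vec (R : realType) (m n : nat) (j : 'I_m) (k : 'I_n) :
  'cV[R]_(n * m) := vec (delta_mx j k).

Definition row_vec (R : realType) (m n : nat) (j : 'I_m) : 'cV[R]_(n * m) :=
  \sum_(k < n) unit_vec R j k.

Definition col_vec (R : realType) (m n : nat) (k : 'I_n) : 'cV[R]_(n * m) :=
  \sum_(j < m) unit_vec R j k.

Definition tot_vec (R : realType) (m n : nat) : 'cV[R]_(n * m) :=
  \sum_(j < m) \sum_(k < n) unit_vec R j k.

Definition is_oproj (R : realType) (n : nat) (D : 'M[R]_n) (M : set 'cV[R]_n)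
    (P : 'M[R]_n) : Prop :=
  forall x : 'cV[R]_n,
    M (P *m x) /\ forall y, M y -> (x - P *m x)^T *m D *m y = 0.

(* For D symmetric positive definite and M a linear subspace there is exactly
   one such matrix; [xget] picks it. *)
Definition oproj (R : realType) (n : nat) (D : 'M[R]_n) (M : set 'cV[R]_n) :
  'M[R]_n := xget 0 [set P | is_oproj D M P].

(* The parameters rho and gamma are stored without the entries of index 0,
   which are constrained to vanish; [ext0] puts these back. *)
Record params (R : realType) (J K L : nat) := Params {
  p_alpha : R;
  p_rho : 'cV[R]_J;
  p_gamma : 'cV[R]_K;
  p_theta : 'cV[R]_L }.

Definition ext0 (R : realType) (n : nat) (v : 'cV[R]_n) (i : 'I_n.+1) : R :=
  if unlift ord0 i is Some i' then v i' 0 else 0.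

Definition loglin (R : realType) (J K L : nat)
    (z : 'I_J.+1 -> 'I_K.+1 -> 'cV[R]_L) (p : params R J K L) :
    'M[R]_(J.+1, K.+1) :=
  \matrix_(j, k) (p_alpha p + ext0 (p_rho p) j + ext0 (p_gamma p) k
                  + ((z j k)^T *m p_theta p) 0 0).

Definition spaceH (R : realType) (J K L : nat)
    (z : 'I_J.+1 -> 'I_K.+1 -> 'cV[R]_L) : set 'cV[R]_(K.+1 * J.+1) :=
  [set x | exists p, x = vec (loglin z p)].

Definition logtable (R : realType) (m n : nat) (mu : 'M[R]_(m, n)) :
  'M[R]_(m, n) := map_mx (@ln R) mu.

Definition lambda_par (R : realType) (J K L : nat) (p : params R J K L) :
  'cV[R]_(K + L) := col_mx (p_gamma p) (p_theta p).

(* Multinomial, Poisson, row-multinomial and column-multinomial sampling. *)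
Inductive scheme := SchM | SchP | SchMR | SchMC.

Definition spaceN (R : realType) (J K : nat) (s : scheme) :
    {vspace 'cV[R]_(K.+1 * J.+1)} :=
  match s with
  | SchM => <[tot_vec R J.+1 K.+1]>%VS
  | SchP => 0%VS
  | SchMR => (\sum_(j < J.+1) <[@row_vec R J.+1 K.+1 j]>)%VS
  | SchMC => (\sum_(k < K.+1) <[@col_vec R J.+1 K.+1 k]>)%VS
  end.

(* The multinomial law is parametrised by its mean vector [m]: the number of
   trials is the sum of [m] and the cell probabilities are m i / sum of m. *)
Definition multinomial_pmf (R : realType) (I : finType) (m : I -> R)
    (r : I -> nat) : R :=
  let M := \sum_i m i in
  if (\sum_i r i)%N%:R == M then
    ((\sum_i r i)%N)`!%:R * \prod_i ((m i / M) ^+ r i / (r i)`!%:R)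
  else 0.

Definition scheme_pmf (R : realType) (J K : nat) (s : scheme)
    (mu : 'M[R]_(J.+1, K.+1)) (r : 'M[nat]_(J.+1, K.+1)) : R :=
  match s with
  | SchM => multinomial_pmf (fun i : 'I_J.+1 * 'I_K.+1 => mu i.1 i.2)
                            (fun i => r i.1 i.2)
  | SchP => \prod_j \prod_k poisson_pmf (mu j k) (r j k)
  | SchMR => \prod_j multinomial_pmf (mu j) (r j)
  | SchMC => \prod_k multinomial_pmf (mu^~ k) (r^~ k)
  end.

Definition sampled (R : realType) (J K : nat) (s : scheme)
    (mu : 'M[R]_(J.+1, K.+1)) (d : measure_display) (T : measurableType d)
    (P : probability T R) (tab : T -> 'M[nat]_(J.+1, K.+1)) : Prop :=
  forall r, measurable (tab @^-1` [set r]) /\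
            P (tab @^-1` [set r]) = (scheme_pmf s mu r)%:E.

(* In the multinomial schemes the likelihood of the table [r] vanishes unless
   the fixed totals of [m] are those of [r], so the maximum is over the tables
   with the totals fixed by the design. *)
Definition is_mle (R : realType) (J K L : nat) (s : scheme)
    (z : 'I_J.+1 -> 'I_K.+1 -> 'cV[R]_L) (r : 'M[nat]_(J.+1, K.+1))
    (mu : 'M[R]_(J.+1, K.+1)) : Prop :=
  let admissible (m : 'M[R]_(J.+1, K.+1)) :=
    (forall j k, 0 < m j k) /\ spaceH z (vec (logtable m)) in
  admissible mu /\
  forall m, admissible m -> scheme_pmf s m r <= scheme_pmf s mu r.

Definition mle_exists (R : realType) (J K L : nat) (s : scheme)
    (z : 'I_J.+1 -> 'I_K.+1 -> 'cV[R]_L) (r : 'M[nat]_(J.+1, K.+1)) : Prop :=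
  exists mu, is_mle s z r mu.

Definition Dmx (R : realType) (J K : nat) (mu : 'M[R]_(J.+1, K.+1)) :
  'M[R]_(K.+1 * J.+1) := diag_mx (vec mu)^T.

(* Asymptotic covariance matrix of the maximum likelihood estimator of the
   vector of log expectations, as given by Haberman's theorem. *)
Definition Sigma_eta (R : realType) (J K L : nat)
    (z : 'I_J.+1 -> 'I_K.+1 -> 'cV[R]_L) (s : scheme)
    (mu : 'M[R]_(J.+1, K.+1)) : 'M[R]_(K.+1 * J.+1) :=
  (oproj (Dmx mu) (spaceH z) - oproj (Dmx mu) [set` spaceN R J K s])
    *m invmx (Dmx mu).

Definition reads_off (R : realType) (J K L q : nat)
    (z : 'I_J.+1 -> 'I_K.+1 -> 'cV[R]_L) (g : params R J K L -> 'cV[R]_q)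
    (A : 'M[R]_(q, K.+1 * J.+1)) : Prop :=
  forall p, A *m vec (loglin z p) = g p.

(* [S] is the asymptotic covariance matrix of the estimator [g \o phat] of the
   parameter [g], where [muhat] is the maximum likelihood estimator and [phat]
   the parameter values representing its logarithm: the estimator is a linear
   function A of the estimated log expectations, and S = A Sigma_eta A^T.  The
   matrix A is determined on the space H only; both its existence and the
   independence of S from its choice are part of the assertion. *)
Definition is_acov (R : realType) (J K L q : nat)
    (z : 'I_J.+1 -> 'I_K.+1 -> 'cV[R]_L) (s : scheme)
    (mu : 'M[R]_(J.+1, K.+1)) (T : Type) (tab : T -> 'M[nat]_(J.+1, K.+1))
    (muhat : T -> 'M[R]_(J.+1, K.+1)) (phat : T -> params R J K L)
    (g : params R J K L -> 'cV[R]_q) (S : 'M[R]_q) : Prop :=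
  (exists A, reads_off z g A) /\
  forall A, reads_off z g A ->
    (forall w, mle_exists s z (tab w) ->
       g (phat w) = A *m vec (logtable (muhat w))) /\
    S = A *m Sigma_eta z s mu *m A^T.

(* The index set {1..J} x {1..K} is 'I_J * 'I_K, embedded in the full index
   set by [lift ord0]; [unit_vec R j k] below is in R^(JK) and fixes the order
   of the rows of [Zo] and of the columns of [Cmx]. *)
Definition Zo (R : realType) (J K L : nat)
    (z : 'I_J.+1 -> 'I_K.+1 -> 'cV[R]_L) : 'M[R]_(K * J, L) :=
  \sum_(j < J) \sum_(k < K)
    unit_vec R j k *m (z (lift ord0 j) (lift ord0 k))^T.

Definition Zinv (R : realType) (J K L : nat)
    (z : 'I_J.+1 -> 'I_K.+1 -> 'cV[R]_L) : 'M[R]_(L, K * J) :=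
  invmx ((Zo z)^T *m Zo z) *m (Zo z)^T.

Definition c_vec (R : realType) (J K : nat) (j : 'I_J) (k : 'I_K) :
    'cV[R]_(K.+1 * J.+1) :=
  let j' := lift ord0 j in
  let k' := lift ord0 k in
  unit_vec R j' k' + unit_vec R ord0 ord0
    - unit_vec R j' ord0 - unit_vec R ord0 k'.

Definition Cmx (R : realType) (J K : nat) : 'M[R]_(K.+1 * J.+1, K * J) :=
  \sum_(j < J) \sum_(k < K) c_vec R j k *m (unit_vec R j k)^T.

Definition Bmx (R : realType) (J K : nat) : 'M[R]_(K.+1 * J.+1, K) :=
  \matrix_(i, k) (@unit_vec R J.+1 K.+1 ord0 (lift ord0 k)
                  - unit_vec R ord0 ord0) i 0.

Definition Sigma_lambda (R : realType) (J K L : nat)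
    (z : 'I_J.+1 -> 'I_K.+1 -> 'cV[R]_L) (s : scheme)
    (mu : 'M[R]_(J.+1, K.+1)) : 'M[R]_(K + L) :=
  col_mx (Bmx R J K)^T (Zinv z *m (Cmx R J K)^T)
    *m Sigma_eta z s mu
    *m row_mx (Bmx R J K) (Cmx R J K *m (Zinv z)^T).

Definition Sigma_theta (R : realType) (J K L : nat)
    (z : 'I_J.+1 -> 'I_K.+1 -> 'cV[R]_L) (mu : 'M[R]_(J.+1, K.+1)) : 'M[R]_L :=
  Zinv z *m (Cmx R J K)^T *m oproj (Dmx mu) (spaceH z) *m invmx (Dmx mu)
    *m Cmx R J K *m (Zinv z)^T.

(* Main.v *)
(* If A and A' both read off the same parameter from the tables of the model,
   they agree on H, which contains the columns of both projections; so
   A Sigma_eta = A' Sigma_eta, and as Sigma_eta is symmetric the covariance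
   A Sigma_eta A^T does not depend on the choice of A.  It then suffices that
   B^T reads off gamma and, C^T being Zo theta on H, that Zinv C^T reads off
   theta.  The latter kills the additive tables, hence N. *)
Require Import Defs.
From HB Require Import structures.
From mathcomp Require Import all_boot all_order all_algebra.
From mathcomp Require Import all_classical all_reals all_analysis.

From mathcomp Require Import ring.

Import Order.TTheory GRing.Theory Num.Theory.

Local Open Scope classical_set_scope.
Local Open Scope ring_scope.

(** * Anisotropic forms and the projections orthogonal for them *)

(** The consequence of positive definiteness that makes Gram matrices invertible. *)
Definition anisotropic {R : realType} {n : nat} (D : 'M[R]_n) : Prop :=
  forall x : 'cV[R]_n, x^T *m D *m x = 0 -> x = 0.

Lemma diag_mx_anisotropic {R : realType} {n : nat} (d : 'rV[R]_n) :
  (forall i, 0 < d 0 i) -> anisotropic (diag_mx d).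
Proof.
move=> d_gt0 x /matrixP/(_ 0 0).
rewrite -mulmxA mul_diag_mx !mxE => /eqP.
rewrite psumr_eq0 => [/allP x0|i _]; last first.
  by rewrite !mxE mulrCA -expr2 mulr_ge0 ?sqr_ge0 // ltW.
apply/colP => i; have := x0 i (mem_index_enum i).
by rewrite !mxE mulrCA -expr2 mulf_eq0 gt_eqF //= sqrf_eq0 => /eqP.
Qed.

(** If v annihilates the Gram matrix, then X v^T has D-norm 0, so X v^T = 0 by anisotropy, and v = 0
    because the columns of X are independent. *)
Lemma gram_unitmx {R : realType} {n m : nat} {D : 'M[R]_n} (X : 'M[R]_(n, m)) :
  anisotropic D -> row_free X^T -> X^T *m D *m X \in unitmx.
Proof.
move=> aniD freeX; rewrite -row_free_unit; apply: inj_row_free => v vG0.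
apply: (row_free_inj freeX); rewrite mul0mx; apply: trmx_inj.
rewrite trmx0; apply: aniD.
by rewrite trmxK trmx_mul trmxK !mulmxA -2!(mulmxA v) vG0 mul0mx.
Qed.

Lemma anisotropic_unitmx {R : realType} {n : nat} {D : 'M[R]_n} :
  anisotropic D -> D \in unitmx.
Proof.
move=> aniD; have := gram_unitmx 1%:M aniD.
by rewrite trmx1 mul1mx mulmx1 row_free_unit unitmx1; apply.
Qed.

(** The choice made by [oproj] is meaningful once some projection exists. With a basis of U as the
    columns of X and G = X^T D X, the classical formula X G^-1 X^T D gives one. *)
Lemma oprojP {R : realType} {n : nat} {D : 'M[R]_n} (U : {vspace 'cV[R]_n}) :
  D^T = D -> anisotropic D -> is_oproj D [set` U] (oproj D [set` U]).
Proof.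
move=> symD aniD.
pose X : 'M[R]_(n, \dim U) := \matrix_(i, j) (vbasis U)`_j i 0.
have XE c : X *m c = \sum_j c j 0 *: (vbasis U)`_j.
  apply/colP => i; rewrite mxE summxE; apply: eq_bigr => j _.
  by rewrite !mxE mulrC.
have XU c : X *m c \in U.
  by rewrite XE memv_suml // => j _; rewrite memvZ ?vbasis_mem ?mem_nth ?size_tuple.
have UX y : y \in U -> exists c, y = X *m c.
  move=> /coord_vbasis yE; exists (\col_j coord (vbasis U) j y).
  by rewrite XE {1}yE; apply: eq_bigr => j _; rewrite mxE.
have freeX : row_free X^T.
  apply: inj_row_free => v vX0; apply/rowP => j; rewrite [RHS]mxE.
  have /freeP := basis_free (vbasisP U).
  move=> /(_ (v 0)); apply; transitivity (X *m v^T).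
    by rewrite XE; apply: eq_bigr => k _; rewrite mxE.
  by apply: trmx_inj; rewrite trmx_mul trmxK vX0 trmx0.
have unitG := gram_unitmx X aniD freeX.
set G := X^T *m D *m X in unitG.
have symG : G^T = G by rewrite /G !trmx_mul trmxK symD mulmxA.
apply: (@xgetPex _ 0 [set P | is_oproj D [set` U] P]).
exists (X *m invmx G *m X^T *m D) => x; split; first by rewrite /= -!mulmxA XU.
move=> _ /UX[c ->]; rewrite linearB /= !trmx_mul trmxK symD trmx_inv symG.
rewrite !mulmxBl; apply/eqP; rewrite subr_eq0; apply/eqP.
by rewrite !mulmxA -2!(mulmxA (_ *m invmx G)) -/G mulmxKV.
Qed.

(** P^T D P = D P, and the left side is symmetric, so D P is symmetric too; multiplying by D^-1 on
    both sides gives the claim. *)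
Lemma oproj_sym {R : realType} {n : nat} {D : 'M[R]_n} {M : set 'cV[R]_n}
    {P : 'M[R]_n} :
  D^T = D -> D \in unitmx -> is_oproj D M P ->
  (P *m invmx D)^T = P *m invmx D.
Proof.
move=> symD unitD projP.
(* Entrywise, this says that the residual of the i-th unit vector is D-orthogonal to the j-th column
   of P, which lies in M. *)
have PtDP : P^T *m D *m P = D *m P.
  apply/eqP; rewrite eq_sym -subr_eq0 -!mulmxBl -{1}(mul1mx D) -mulmxBl.
  apply/eqP/matrixP => i j.
  have := (projP (delta_mx i 0)).2 _ (projP (delta_mx j 0)).1.
  rewrite -{1}(mul1mx (delta_mx i 0)) -mulmxBl trmx_mul trmx_delta linearB /=.
  rewrite trmx1 -!mulmxA -rowE !mulmxA -colE => /matrixP/(_ 0 0).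
  by rewrite !mxE.
have DPsym : P^T *m D = D *m P.
  by rewrite -PtDP -[in LHS]symD -trmx_mul -PtDP !trmx_mul trmxK symD mulmxA.
rewrite trmx_mul trmx_inv symD -[LHS](mulmxK unitD) -(mulmxA _ P^T) DPsym.
by rewrite mulKmx.
Qed.

Lemma eq_mulmx_oproj {R : realType} {n q : nat} {D P : 'M[R]_n}
    {M : set 'cV[R]_n} {A B : 'M[R]_(q, n)} :
  is_oproj D M P -> (forall x, M x -> A *m x = B *m x) -> A *m P = B *m P.
Proof.
move=> projP AB; apply/matrixP => i j.
have /matrixP/(_ i 0) := AB _ (projP (delta_mx j 0)).1.
by rewrite !mulmxA -!colE !mxE.
Qed.

(** * Vectorized tables and parameters with a zero entry at index 0 *)

Lemma vecE {R : Type} {m n : nat} (a : 'M[R]_(m, n)) j k :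
  vec a (mxvec_index k j) 0 = a j k.
Proof. by rewrite mxE mxvecE mxE. Qed.

Lemma unit_vecE {R : realType} {m n : nat} (j : 'I_m) (k : 'I_n) :
  unit_vec R j k = delta_mx (mxvec_index k j) 0.
Proof. by rewrite /unit_vec /vec trmx_delta mxvec_delta trmx_delta. Qed.

Lemma unit_vecT_vec {R : realType} {m n : nat} (j : 'I_m) (k : 'I_n)
    (a : 'M[R]_(m, n)) :
  (unit_vec R j k)^T *m vec a = (a j k)%:M.
Proof.
by rewrite unit_vecE trmx_delta -rowE [LHS]mx11_scalar mxE vecE.
Qed.

Lemma vec_sum_unit {R : realType} {m n : nat} (a : 'M[R]_(m, n)) :
  vec a = \sum_j \sum_k a j k *: unit_vec R j k.
Proof.
rewrite {1}[a]matrix_sum_delta /vec !linear_sum; apply: eq_bigr => j _ /=.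
by rewrite !linear_sum; apply: eq_bigr => k _ /=; rewrite !linearZ.
Qed.

Lemma ext0_lift {R : realType} {n : nat} (v : 'cV[R]_n) i :
  ext0 v (lift ord0 i) = v i 0.
Proof. by rewrite /ext0 liftK. Qed.

Lemma ext0_0 {R : realType} {n : nat} (v : 'cV[R]_n) : ext0 v ord0 = 0.
Proof. by rewrite /ext0 unlift_none. Qed.

Lemma ext0P {R : realType} {n : nat} a (u v : 'cV[R]_n) i :
  ext0 (a *: u + v) i = a * ext0 u i + ext0 v i.
Proof.
by rewrite /ext0; case: unlift => [i'|]; rewrite ?mxE // mulr0 addr0.
Qed.

(** Serves to bring an additive table u_j + v_k to the normalization rho_0 = gamma_0 = 0. *)
Lemma ext0B {R : realType} {n : nat} (f : 'I_n.+1 -> R) i :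
  f ord0 + ext0 (\col_i (f (lift ord0 i) - f ord0)) i = f i.
Proof.
rewrite /ext0; case: unliftP => [i' ->|->]; last by rewrite addr0.
by rewrite mxE addrC subrK.
Qed.

Lemma loglin_border {R : realType} {J K L : nat}
    {z : 'I_J.+1 -> 'I_K.+1 -> 'cV[R]_L} (p : params R J K L) {j k} :
  z j k = 0 ->
  loglin z p j k = p_alpha p + ext0 (p_rho p) j + ext0 (p_gamma p) k.
Proof. by move=> z0; rewrite mxE z0 trmx0 mul0mx mxE addr0. Qed.

(** * The model space and the spaces of the sampling schemes *)

(** The model space is the image of the linear map from parameters to vectors; in this form [oprojP]
    applies to it. *)
Lemma spaceH_vspace {R : realType} {J K L : nat}
    (z : 'I_J.+1 -> 'I_K.+1 -> 'cV[R]_L) :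
  exists U : {vspace 'cV[R]_(K.+1 * J.+1)}, spaceH z = [set` U].
Proof.
(* The intercept is stored as a 1 x 1 matrix, so that all four factors are matrix spaces. *)
pose f (w : 'M[R]_1 * 'cV[R]_J * 'cV[R]_K * 'cV[R]_L) :=
  vec (loglin z (Params (w.1.1.1 0 0) w.1.1.2 w.1.2 w.2)).
have lin_f : linear f.
  move=> a [[[a1 r1] c1] t1] [[[a2 r2] c2] t2]; apply/colP.
  case/mxvec_indexP => k j; rewrite /f [RHS]mxE [X in _ = X + _]mxE !vecE.
  rewrite /loglin [LHS]mxE ![in RHS]mxE /= !ext0P.
  by rewrite mulmxDr -scalemxAr !mxE; ring.
pose g : {linear _ -> _} := HB.pack f (GRing.isLinear.Build _ _ _ _ f lin_f).
have [h hE] : exists h : 'Hom(_, _), forall w, h w = f w.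
  by exists (linfun g) => w; rewrite lfunE.
exists (limg h); apply/seteqP; split => [_ [[a r c t] ->]|x] /=.
  by apply/memv_imgP; exists (a%:M, r, c, t); rewrite ?memvf // hE /f /= mxE.
case/memv_imgP => [[[[a r] c] t] _ ->]; rewrite hE.
by exists (Params (a 0 0) r c t).
Qed.

(** Each generator of N is an additive table u_j + v_k, and the additive tables form a linear space,
    namely the model space for L = 0. An additive table belongs to every model, with theta = 0. *)
Lemma spaceN_loglin {R : realType} {J K L : nat}
    (z : 'I_J.+1 -> 'I_K.+1 -> 'cV[R]_L) (s : scheme) x :
  x \in spaceN R J K s -> exists2 p, p_theta p = 0 & x = vec (loglin z p).
Proof.
have addH (u : 'I_J.+1 -> R) (v : 'I_K.+1 -> R) :
    spaceH (fun _ _ => 0 : 'cV[R]_0) (vec (\matrix_(j, k) (u j + v k))).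
  (* The intercept is the corner cell; the row and column effects are differences from index 0. *)
  exists (Params (u ord0 + v ord0) (\col_j (u (lift ord0 j) - u ord0))
    (\col_k (v (lift ord0 k) - v ord0)) 0).
  congr vec; apply/matrixP => j k; rewrite mxE [RHS]mxE /= mulmx0.
  by rewrite [X in _ = _ + X]mxE addr0 -[in LHS](ext0B u j) -[in LHS](ext0B v k) addrACA addrA.
have [U TU] := spaceH_vspace (fun (_ : 'I_J.+1) (_ : 'I_K.+1) => 0 : 'cV[R]_0).
have memU y u v : y = vec (\matrix_(j, k) (u j + v k)) -> y \in U.
  by move=> ->; have := addH u v; rewrite TU.
have NU : (spaceN R J K s <= U)%VS.
  case: s => /=.
  (* The generators are additive with (u, v) equal to (1, 0) for the total, (indicator of j, 0) for
     a row and (0, indicator of k) for a column. *)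
  - rewrite -memvE (memU _ (fun=> 1) (fun=> 0)) // vec_sum_unit.
    apply: eq_bigr => j _; apply: eq_bigr => k _.
    by rewrite mxE addr0 scale1r.
  - exact: sub0v.
  - apply/subv_sumP => j _.
    rewrite -memvE (memU _ (fun i => (i == j)%:R) (fun=> 0)) // vec_sum_unit.
    rewrite (bigD1 j) //= [X in _ + X]big1 => [|i /negPf ij].
      by rewrite addr0; apply: eq_bigr => k _; rewrite mxE eqxx addr0 scale1r.
    by rewrite big1 // => k _; rewrite mxE ij addr0 scale0r.
  - apply/subv_sumP => k _.
    rewrite -memvE (memU _ (fun=> 0) (fun i => (i == k)%:R)) // vec_sum_unit.
    apply: eq_bigr => j _; rewrite (bigD1 k) //= [X in _ + X]big1 ?addr0.
      by rewrite mxE eqxx add0r scale1r.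
    by move=> i /negPf ij; rewrite mxE ij add0r scale0r.
move=> /(subvP NU) xU; have : [set` U] x by [].
rewrite -TU => -[p ->]; exists (Params (p_alpha p) (p_rho p) (p_gamma p) 0) => //.
by congr vec; apply/matrixP => j k; rewrite mxE [RHS]mxE /= trmx0 mul0mx mulmx0 !mxE.
Qed.

(** * Matrices that recover gamma and theta from the log expectations *)

Lemma reads_off_Bmx {R : realType} {J K L : nat}
    {z : 'I_J.+1 -> 'I_K.+1 -> 'cV[R]_L} :
  (forall k, z ord0 k = 0) -> reads_off z (@p_gamma R J K L) (Bmx R J K)^T.
Proof.
move=> hz p; apply/colP => k.
have -> : ((Bmx R J K)^T *m vec (loglin z p)) k 0 =
    ((@unit_vec R J.+1 K.+1 ord0 (lift ord0 k) - unit_vec R ord0 ord0)^T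
      *m vec (loglin z p)) 0 0.
  by rewrite !mxE; apply: eq_bigr => i _; rewrite !mxE.
(* In row 0 only alpha and gamma survive, so eta_0k - eta_00 = gamma_k. *)
rewrite linearB /= mulmxBl !unit_vecT_vec -raddfB /= [LHS]mxE mulr1n.
by rewrite !loglin_border // ext0_lift !ext0_0 !addr0 addrC addKr.
Qed.

(** The contrast eta_jk + eta_00 - eta_j0 - eta_0k cancels alpha, rho_j and gamma_k; its three
    border cells carry no interaction, so z_jk^T theta is left. *)
Lemma CmxT_loglin {R : realType} {J K L : nat}
    {z : 'I_J.+1 -> 'I_K.+1 -> 'cV[R]_L} (p : params R J K L) :
  (forall j, z j ord0 = 0) -> (forall k, z ord0 k = 0) ->
  (Cmx R J K)^T *m vec (loglin z p) = Zo z *m p_theta p.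
Proof.
move=> hzc hzr; rewrite /Cmx /Zo linear_sum !mulmx_suml.
apply: eq_bigr => j _ /=; rewrite linear_sum !mulmx_suml.
apply: eq_bigr => k _ /=; rewrite trmx_mul trmxK -!mulmxA; congr (_ *m _).
rewrite /c_vec !linearB linearD /= !mulmxBl mulmxDl !unit_vecT_vec.
rewrite -raddfD -!raddfB /= [RHS]mx11_scalar; congr (_%:M).
rewrite !(loglin_border _ (hzc _)) (loglin_border _ (hzr _)).
by rewrite [loglin _ _ _ _]mxE !ext0_lift !ext0_0 !addr0; ring.
Qed.

Lemma Zinv_Zo {R : realType} {J K L : nat}
    {z : 'I_J.+1 -> 'I_K.+1 -> 'cV[R]_L} :
  \rank (Zo z) = L -> Zinv z *m Zo z = 1%:M.
Proof.
move=> rkZ; rewrite /Zinv -mulmxA mulVmx //.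
(* Full column rank makes the Gram matrix of [Zo z] invertible, by [gram_unitmx] for the identity
   form. *)
have aniI : anisotropic (1%:M : 'M[R]_(K * J)).
  by rewrite -diag_const_mx; apply: diag_mx_anisotropic => i; rewrite mxE.
have := gram_unitmx (Zo z) aniI.
by rewrite mulmx1; apply; rewrite /row_free mxrank_tr rkZ.
Qed.

Lemma reads_off_Zinv {R : realType} {J K L : nat}
    {z : 'I_J.+1 -> 'I_K.+1 -> 'cV[R]_L} :
  (forall j, z j ord0 = 0) -> (forall k, z ord0 k = 0) -> \rank (Zo z) = L ->
  reads_off z (@p_theta R J K L) (Zinv z *m (Cmx R J K)^T).
Proof.
by move=> hzc hzr rkZ p; rewrite -mulmxA CmxT_loglin // mulmxA Zinv_Zo // mul1mx.
Qed.

(** * Covariances of parameters read off the estimated log expectations *)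

Section Covariance.
Context {R : realType} {J K L : nat} (z : 'I_J.+1 -> 'I_K.+1 -> 'cV[R]_L).
Context {mu : 'M[R]_(J.+1, K.+1)}.
Hypothesis mu_gt0 : forall j k, 0 < mu j k.

Let D := Dmx mu.

Let D_sym : D^T = D. Proof. exact: tr_diag_mx. Qed.

Let D_aniso : anisotropic D.
Proof.
apply: diag_mx_anisotropic; case/mxvec_indexP => k j.
by rewrite mxE vecE.
Qed.

Let projH : is_oproj D (spaceH z) (oproj D (spaceH z)).
Proof. by have [U ->] := spaceH_vspace z; apply: oprojP. Qed.

Let projN s : is_oproj D [set` spaceN R J K s] (oproj D [set` spaceN R J K s]).
Proof. exact: oprojP. Qed.

Lemma Sigma_eta_sym s : (Sigma_eta z s mu)^T = Sigma_eta z s mu.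
Proof.
have unitD := anisotropic_unitmx D_aniso.
rewrite /Sigma_eta mulmxBl linearB /=.
by rewrite (oproj_sym D_sym unitD projH) (oproj_sym D_sym unitD (projN s)).
Qed.

Lemma reads_off_Sigma_eta {s q} {g : params R J K L -> 'cV[R]_q}
    {A A' : 'M[R]_(q, K.+1 * J.+1)} :
  reads_off z g A -> reads_off z g A' ->
  A *m Sigma_eta z s mu = A' *m Sigma_eta z s mu.
Proof.
move=> hA hA'; rewrite /Sigma_eta !mulmxA; congr (_ *m _); rewrite !mulmxBr.
congr (_ - _).
  by apply: (eq_mulmx_oproj projH) => _ [p ->]; rewrite hA hA'.
apply: (eq_mulmx_oproj (projN s)) => _ /(spaceN_loglin z)[p _ ->].
by rewrite hA hA'.
Qed.

(** The left factor is exchanged directly, the right one after transposition. Two parameters g and h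
    are allowed in order to cover the cross-covariance blocks. *)
Lemma reads_off_cov {s q r} {g : params R J K L -> 'cV[R]_q}
    {h : params R J K L -> 'cV[R]_r} {A A' B B'} :
  reads_off z g A -> reads_off z g A' -> reads_off z h B -> reads_off z h B' ->
  A *m Sigma_eta z s mu *m B^T = A' *m Sigma_eta z s mu *m B'^T.
Proof.
move=> hA hA' hB hB'.
move: (Sigma_eta_sym s) (@reads_off_Sigma_eta s _ _ _ _ hA hA').
move: (@reads_off_Sigma_eta s _ _ _ _ hB hB').
generalize (Sigma_eta z s mu) => S BS S_sym ->; rewrite -!mulmxA.
by congr (_ *m _); apply: trmx_inj; rewrite !trmx_mul !trmxK S_sym.
Qed.

Lemma is_acov_reads_off {s q} {g : params R J K L -> 'cV[R]_q} {A}
    {T : Type} {tab : T -> 'M[nat]_(J.+1, K.+1)}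
    {muhat : T -> 'M[R]_(J.+1, K.+1)} {phat : T -> params R J K L} :
  (forall w, mle_exists s z (tab w) ->
     logtable (muhat w) = loglin z (phat w)) ->
  reads_off z g A ->
  is_acov z s mu tab muhat phat g (A *m Sigma_eta z s mu *m A^T).
Proof.
move=> hphat hA; split=> [|B hB]; first by exists A.
split=> [w /hphat ->|]; first by rewrite hB.
exact: reads_off_cov.
Qed.

(** Vectors of N are represented with theta = 0, so A vanishes on N and the second projection drops
    out under every scheme. *)
Lemma reads_off_theta_cov s {A} : reads_off z (@p_theta R J K L) A ->
  A *m Sigma_eta z s mu *m A^T =
  A *m oproj D (spaceH z) *m invmx D *m A^T.
Proof.
move=> hA; rewrite /Sigma_eta mulmxA mulmxBr.
suff -> : A *m oproj D [set` spaceN R J K s] = 0 by rewrite subr0.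
rewrite (eq_mulmx_oproj (B := 0) (projN s)) ?mul0mx //.
by move=> _ /(spaceN_loglin z)[p p0 ->]; rewrite hA p0 mul0mx.
Qed.

End Covariance.

Theorem theorem1 (R : realType) (J K L : nat)
  (hJ : (1 <= J)%N) (hK : (1 <= K)%N)
  (z : 'I_J.+1 -> 'I_K.+1 -> 'cV[R]_L)
  (hz_col : forall j, z j ord0 = 0) (hz_row : forall k, z ord0 k = 0)
  (hZ : \rank (Zo z) = L)
  (mu : 'M[R]_(J.+1, K.+1))
  (hmu : forall j k, 0 < mu j k)
  (hmodel : spaceH z (vec (logtable mu)))
  (s : scheme)
  (d : measure_display) (T : measurableType d) (P : probability T R)
  (tab : T -> 'M[nat]_(J.+1, K.+1))
  (hsampled : sampled s mu P tab)
  (hmean : forall j k, ('E_P[fun w => (tab w j k)%:R] = (mu j k)%:E)%E)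
  (muhat : T -> 'M[R]_(J.+1, K.+1))
  (hmuhat : forall w, mle_exists s z (tab w) -> is_mle s z (tab w) (muhat w))
  (phat : T -> params R J K L)
  (hphat : forall w, mle_exists s z (tab w) ->
     logtable (muhat w) = loglin z (phat w)) :
  [/\ is_acov z s mu tab muhat phat (@lambda_par R J K L)
        (Sigma_lambda z s mu),
      exists (Sgamma : 'M[R]_K) (Sgt : 'M[R]_(K, L)) (Stg : 'M[R]_(L, K)),
        [/\ Sigma_lambda z s mu = block_mx Sgamma Sgt Stg (Sigma_theta z mu),
            is_acov z s mu tab muhat phat (@p_gamma R J K L) Sgamma
          & forall A B, reads_off z (@p_gamma R J K L) A ->
              reads_off z (@p_theta R J K L) B ->
              Sgt = A *m Sigma_eta z s mu *m B^T /\
              Stg = B *m Sigma_eta z s mu *m A^T],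
      is_acov z s mu tab muhat phat (@p_theta R J K L) (Sigma_theta z mu)
    & forall s' : scheme,
        drsubmx (Sigma_lambda z s' mu) = Sigma_theta z mu].
Proof.
have hB := reads_off_Bmx hz_row.
have hC := reads_off_Zinv hz_col hz_row hZ.
have thetaE s' : Zinv z *m (Cmx R J K)^T *m Sigma_eta z s' mu
    *m (Zinv z *m (Cmx R J K)^T)^T = Sigma_theta z mu.
  by rewrite reads_off_theta_cov // trmx_mul trmxK !mulmxA.
(* The right factor of [Sigma_lambda] is the transpose of the left one, which gives the form A Sigma
   A^T. *)
have lambdaE s' : Sigma_lambda z s' mu =
    col_mx (Bmx R J K)^T (Zinv z *m (Cmx R J K)^T) *m Sigma_eta z s' mu
      *m (col_mx (Bmx R J K)^T (Zinv z *m (Cmx R J K)^T))^T.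
  by rewrite tr_col_mx trmx_mul !trmxK.
split.
- rewrite lambdaE; apply: is_acov_reads_off => // p.
  by rewrite mul_col_mx hB hC.
(* The double transpose keeps the blocks in the form A Sigma B^T, with A and B the two matrices that
   read off gamma and theta. *)
- exists ((Bmx R J K)^T *m Sigma_eta z s mu *m (Bmx R J K)^T^T).
  exists ((Bmx R J K)^T *m Sigma_eta z s mu *m (Zinv z *m (Cmx R J K)^T)^T).
  exists (Zinv z *m (Cmx R J K)^T *m Sigma_eta z s mu *m (Bmx R J K)^T^T).
  split.
  + by rewrite -(thetaE s) lambdaE tr_col_mx mul_col_mx mul_col_row.
  + exact: is_acov_reads_off.
  + by move=> A B hA hB'; split; apply: reads_off_cov.
- by rewrite -(thetaE s); apply: is_acov_reads_off.
- move=> s'; rewrite lambdaE tr_col_mx mul_col_mx mul_col_row block_mxKdr.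
  exact: thetaE.
Qed.
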